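(* Assume that the numbers of degrees of freedom $N_1,\dots,N_n$ on the mesh sequence satisfy the proportional relationship $$N_k\approx\eta^{\,n-k}N_n,\qquad k=1,2,\dots,n.$$ Then the total computational work of the nonnested augmented subspace method is $$W_{total}=\mathcal{O}\Big(\frac{N+\varpi}{\vartheta}N_n+\varpi\,M_H\log N_n+M_{k_0}\Big).$$
   Context: The nonnested augmented subspace method for the Kohn-Sham equation works on a sequence of $n$ finite element spaces (adaptive meshes), the $k$-th having $N_k$ degrees of freedom. On the first $k_0$ spaces the Kohn-Sham equation is solved directly; on each space $k>k_0$ the method solves $N$ linear boundary value problems on the fine space and a nonlinear eigenvalue problem in a low-dimensional augmented subspace. Notation: $N$ is the number of desired eigenpairs; $\varpi$ is the number of nonlinear iterations; $\vartheta$ is the number of (parallel) processes; $\eta\in(0,1)$ is the coarsening rate between two consecutive meshes, a constant; $x\approx y$ means equality up to multiplicative constants (bounded above and below) that are independent of the mesh. Computational work model: the total work for solving the Kohn-Sham equation in the first $k_0$ spaces is $\mathcal{O}(M_{k_0})$; the work of solving the small-scale algebraic eigenvalue problem in the augmented subspace (per nonlinear iteration) is $\mathcal{O}(M_H)$; and the work in the $k$-th space, $k_0<k\le n$, is $$W_k=\mathcal{O}\Big(N\frac{N_k}{\vartheta}+\varpi\Big(\frac{N_k}{\vartheta}+M_H\Big)\Big),$$ with constants independent of $k$. The total work is $W_{total}=\sum_{k=1}^nW_k$, i.e. the work $\mathcal{O}(M_{k_0})$ of the first $k_0$ spaces plus $\sum_{k=k_0+1}^nW_k$. *)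

(* Defs.v *)
From HB Require Import structures.
From mathcomp Require Import all_boot all_order all_algebra.
From mathcomp Require Import all_classical all_reals all_analysis.
Import Order.TTheory GRing.Theory Num.Theory numFieldNormedType.Exports.
Set Implicit Arguments.
Unset Strict Implicit.
Unset Printing Implicit Defensive.
Local Open Scope classical_set_scope.
Local Open Scope ring_scope.

(* Landau estimates with constants uniform over a set: the principal filter
   [globally A] requires them at every point of [A]. *)
Definition bigO_on (R : realType) (T : Type) (A : set T) (f g : T -> R) : Prop :=
  let F := FilterType (globally A) _ in
  (f : T -> R^o) =O_F (g : T -> R^o).

Definition bigTheta_on (R : realType) (T : Type) (A : set T) (f g : T -> R)
  : Prop :=
  let F := FilterType (globally A) _ in
  (f : T -> R^o) =Theta_F (g : T -> R^o).

(* The cost data of one execution of the nonnested augmented subspace method.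
   The values of [dof] and [work] matter only at the levels
   1, ..., [levels]; [work k] is the work actually spent in the k-th space. *)
Record nas_run (R : realType) := NasRun {
  levels : nat;           (* n *)
  direct_levels : nat;    (* k_0 *)
  dof : nat -> nat;       (* N_k *)
  eigenpairs : nat;       (* N *)
  iterations : nat;       (* \varpi *)
  processes : nat;        (* \vartheta *)
  aug_cost : R;           (* M_H *)
  direct_cost : R;        (* M_{k_0} *)
  work : nat -> R;        (* W_k *)
  direct_levels_le : (direct_levels <= levels)%N;
  processes_gt0 : (0 < processes)%N;
  aug_cost_ge0 : 0 <= aug_cost;
  direct_cost_ge0 : 0 <= direct_cost
}.

Section Costs.
Variables (R : realType) (x : nas_run R).

Definition fine_dof : nat := dof x (levels x).

Definition direct_work : R := \sum_(1 <= k < (direct_levels x).+1) work x k.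

Definition total_work : R := \sum_(1 <= k < (levels x).+1) work x k.

Definition level_cost (k : nat) : R :=
  (eigenpairs x)%:R * ((dof x k)%:R / (processes x)%:R)
  + (iterations x)%:R * ((dof x k)%:R / (processes x)%:R + aug_cost x).

Definition total_cost : R :=
  ((eigenpairs x)%:R + (iterations x)%:R) / (processes x)%:R * fine_dof%:R
  + (iterations x)%:R * aug_cost x * ln fine_dof%:R
  + direct_cost x.

End Costs.

(* "Independent of the mesh" is uniformity over a family [run : T -> nas_run R]
   and over the levels: an estimate on the k-th space is a Landau estimate
   between functions of the pair (t, k) on one of the following two sets. *)
Section Levels.
Variables (R : realType) (T : Type) (run : T -> nas_run R).

Definition all_levels : set (T * nat) :=
  [set p | (1 <= p.2 <= levels (run p.1))%N].

Definition corrected_levels : set (T * nat) :=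
  [set p | (direct_levels (run p.1) < p.2 <= levels (run p.1))%N].

End Levels.

(* Main.v *)
(* Summed over the levels, the terms proportional to N_k form a geometric series
   in eta bounded by a multiple of N_n, while the term varpi * M_H is paid once
   per level.  The number of levels is O(log N_n): since N_1 is a positive
   integer, 1 <= N_1 <= C eta^(n-1) N_n, and one takes logarithms, absorbing the
   additive constant because N_n >= 2. *)
Require Import Defs.
From HB Require Import structures.
From mathcomp Require Import all_boot all_order all_algebra.
From mathcomp Require Import all_classical all_reals all_analysis.
From mathcomp Require Import ring lra.
Import Order.TTheory GRing.Theory Num.Theory numFieldNormedType.Exports.
Local Open Scope classical_set_scope.
Local Open Scope ring_scope.

Lemma bigO_onP (R : realType) (T : Type) (A : set T) (f g : T -> R) :
  bigO_on A f g <->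
  exists2 C : R, 0 < C & forall x, A x -> `|f x| <= C * `|g x|.
Proof. exact: eqO_exP. Qed.

Lemma bigTheta_on_bounds (R : realType) (T : Type) (A : set T) (f g : T -> R) :
  bigTheta_on A f g ->
  exists c C : R, [/\ 0 < c, 0 < C &
    forall x, A x -> c * `|g x| <= `|f x| <= C * `|g x|].
Proof.
rewrite /bigTheta_on eqThetaE => /asboolP [[c C] /= /andP[c0 C0] fg].
by exists c, C; split=> // x Ax; apply/andP; exact: fg.
Qed.

(** Passing from [n] to [n.+1] multiplies the sum by [eta] and adds 1; the bound is the fixed point
    of this affine map, so induction preserves it. *)
Lemma sum_geometric_le (R : realType) (eta : R) (n : nat) :
  0 <= eta -> eta < 1 ->
  \sum_(1 <= k < n.+1) eta ^+ (n - k) <= (1 - eta)^-1.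
Proof.
move=> eta_ge0 eta_lt1.
have d0 : 0 < 1 - eta by rewrite subr_gt0.
elim: n => [|n IHn]; first by rewrite big_nil invr_ge0 ltW.
rewrite big_nat_recr//= subnn expr0.
under eq_big_nat => k /andP[_ kn] do rewrite (subSn (kn : (k <= n)%N)) exprS.
rewrite -mulr_sumr (le_trans (lerD (ler_wpM2l eta_ge0 IHn) (lexx 1)))//.
suff -> : eta * (1 - eta)^-1 + 1 = (1 - eta)^-1 by [].
by field; rewrite gt_eqF.
Qed.

(** Serves to bound the number of levels, with [m.+1] levels and [N] finest degrees of freedom. [K]
    is chosen before [m] and [N], hence is uniform over the family of meshes. *)
Lemma exponent_le_ln (R : realType) (eta C : R) : 0 < eta -> eta < 1 -> 0 < C ->
  exists2 K : R, 0 < K & forall m N : nat, (1 < N)%N ->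
    1 <= C * (eta ^+ m * N%:R) -> m.+1%:R <= K * ln N%:R.
Proof.
move=> eta0 eta1 C0.
have L0 : 0 < - ln eta by rewrite oppr_gt0 ln_lt0// eta0.
have l2 : 0 < ln 2 :> R by rewrite ln_gt0// ltr1n.
(* [ln (1 + C)] replaces [ln C], which may be negative, so that [B] is positive. *)
pose B := ln (1 + C) / - ln eta.
have B0 : 0 < B by rewrite divr_gt0// ln_gt0// ltrDl.
(* Taking logarithms gives [m.+1 <= 1 + B + ln N / - ln eta]; since [ln N >= ln 2], the additive
   part [1 + B] is at most [(1 + B) / ln 2 * ln N]. *)
exists ((1 + B) / ln 2 + (- ln eta)^-1).
  by rewrite addr_gt0 ?invr_gt0// divr_gt0// addr_gt0.
move=> m N N1 le1.
have N0 : 0 < N%:R :> R by rewrite ltr0n (ltn_trans _ N1).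
have lnN : ln 2 <= ln N%:R :> R by rewrite ler_ln ?posrE// ler_nat.
have e0 : 0 < eta ^+ m by rewrite exprn_gt0.
have mle : m%:R * - ln eta <= ln (1 + C) + ln N%:R.
  have : ln (C * (eta ^+ m * N%:R)) >= 0 by rewrite ln_ge0.
  rewrite !lnM ?posrE ?mulr_gt0// lnXn// -mulr_natl.
  have : ln C <= ln (1 + C) by rewrite ler_ln ?posrE ?addr_gt0// lerDr.
  by lra.
have {}mle : m%:R <= B + ln N%:R / - ln eta.
  by rewrite -mulrDl ler_pdivlMr.
have : 1 + B <= (1 + B) / ln 2 * ln N%:R.
  by rewrite mulrAC ler_pdivlMr// ler_wpM2l// addr_ge0 ?ltW.
rewrite -natr1 mulrDl; move: mle; rewrite [_ / - ln eta]mulrC; lra.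
Qed.

Lemma total_workE (R : realType) (x : nas_run R) :
  total_work x =
  direct_work x + \sum_((direct_levels x).+1 <= k < (levels x).+1) work x k.
Proof. by rewrite -big_cat_nat//= ltnS direct_levels_le. Qed.

Lemma level_cost_ge0 (R : realType) (x : nas_run R) (k : nat) :
  0 <= level_cost x k.
Proof.
by rewrite /level_cost addr_ge0 ?mulr_ge0 ?addr_ge0 ?mulr_ge0 ?invr_ge0
  ?aug_cost_ge0.
Qed.

Lemma sum_level_cost (R : realType) (x : nas_run R) :
  \sum_(1 <= k < (levels x).+1) level_cost x k =
  ((eigenpairs x)%:R + (iterations x)%:R) / (processes x)%:R *
    \sum_(1 <= k < (levels x).+1) (dof x k)%:R
  + (iterations x)%:R * aug_cost x * (levels x)%:R.
Proof.
rewrite mulr_sumr.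
have -> : (iterations x)%:R * aug_cost x * (levels x)%:R =
    \sum_(1 <= k < (levels x).+1) (iterations x)%:R * aug_cost x.
  by rewrite sumr_const_nat subn1 mulr_natr.
by rewrite -big_split; apply: eq_bigr => k _; rewrite /level_cost/=; ring.
Qed.

Theorem theorem3p3 (R : realType) (eta : R) (T : Type) (run : T -> nas_run R)
  (eta_gt0 : 0 < eta) (eta_lt1 : eta < 1)
  (fine_gt1 : forall t, (1 < fine_dof (run t))%N)
  (dof_proportional :
    bigTheta_on (all_levels run)
      (fun p => (dof (run p.1) p.2)%:R)
      (fun p => eta ^+ (levels (run p.1) - p.2) * (fine_dof (run p.1))%:R))
  (direct_workO :
    bigO_on [set: T] (fun t => direct_work (run t))
                     (fun t => direct_cost (run t)))
  (level_workO :
    bigO_on (corrected_levels run) (fun p => work (run p.1) p.2)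
                                   (fun p => level_cost (run p.1) p.2)) :
  bigO_on [set: T] (fun t => total_work (run t))
                   (fun t => total_cost (run t)).
Proof.
have [c [C [c0 C0 dofP]]] := bigTheta_on_bounds _ _ _ _ _ dof_proportional.
have [D D0 directP] := (bigO_onP _ _ _ _ _).1 direct_workO.
have [E E0 levelP] := (bigO_onP _ _ _ _ _).1 level_workO.
have [K K0 lnP] := exponent_le_ln _ _ _ eta_gt0 eta_lt1 C0.
have d0 : 0 < 1 - eta by rewrite subr_gt0.
pose G := C / (1 - eta).
have G0 : 0 < G by rewrite divr_gt0.
(* [D] pays for the direct levels, [E * G] for the geometric sum of the degrees of freedom and
   [E * K] for the number of levels. *)
apply/bigO_onP; exists (D + E * (G + K)).
  by rewrite addr_gt0// mulr_gt0// addr_gt0.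
move=> t _; set x := run t.
have N1 : (1 < fine_dof x)%N by exact: fine_gt1.
have dofE k : (1 <= k <= levels x)%N ->
    c * (eta ^+ (levels x - k) * (fine_dof x)%:R) <= (dof x k)%:R
    <= C * (eta ^+ (levels x - k) * (fine_dof x)%:R).
  move=> kx; have := dofP (t, k) kx => /=.
  by rewrite normr_nat ger0_norm// mulr_ge0// exprn_ge0// ltW.
have sum_dof :
    \sum_(1 <= k < (levels x).+1) (dof x k)%:R <= G * (fine_dof x)%:R.
  apply: (@le_trans _ _ (\sum_(1 <= k < (levels x).+1)
      C * (fine_dof x)%:R * eta ^+ (levels x - k))).
    apply: ler_sum_nat => k kx; have /andP[_] := dofE k kx.
    by rewrite mulrCA mulrA (mulrC _ C) -!mulrA (mulrC (eta ^+ _)).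
  rewrite -mulr_sumr /G [leRHS]mulrAC ler_wpM2l ?mulr_ge0 ?(ltW C0)//.
  by rewrite sum_geometric_le// ltW.
have levels_le : (levels x)%:R <= K * ln (fine_dof x)%:R.
  (* Without levels there is no [N_1] to compare with, but the bound is then trivial. *)
  have [->|n0] := posnP (levels x).
    by rewrite mulr_ge0 ?(ltW K0)// ln_ge0// ler1n ltnW.
  have /andP[lb ub] := dofE 1 n0.
  (* The exponent of [eta] at level 1 is [levels x - 1], one less than the number of levels. *)
  rewrite -(prednK n0); apply: lnP => //; rewrite -subn1.
  (* The lower Theta-bound makes the coarsest dof positive, hence at least 1. *)
  apply: le_trans ub; rewrite ler1n -(ltr0n R); apply: lt_le_trans lb.
  by rewrite !mulr_gt0 ?exprn_gt0// ltr0n ltnW.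
pose a : R := ((eigenpairs x)%:R + (iterations x)%:R) / (processes x)%:R.
pose b : R := (iterations x)%:R * aug_cost x.
have a0 : 0 <= a by rewrite divr_ge0 ?addr_ge0.
have b0 : 0 <= b by rewrite mulr_ge0 ?aug_cost_ge0.
have l0 : 0 <= ln (fine_dof x)%:R :> R by rewrite ln_ge0// ler1n ltnW.
have M0 := direct_cost_ge0 x.
have corrected : `|\sum_((direct_levels x).+1 <= k < (levels x).+1) work x k|
    <= E * (a * (G * (fine_dof x)%:R) + b * (K * ln (fine_dof x)%:R)).
  apply: le_trans (ler_norm_sum _ _ _) _.
  (* The work estimate holds on the corrected levels only; the costs of the direct levels are
     nonnegative and are added to reach the full sum. *)
  apply: (@le_trans _ _ (E * \sum_(1 <= k < (levels x).+1) level_cost x k)).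
    rewrite (@big_cat_nat _ _ _ (direct_levels x).+1 1)//=; last first.
      by rewrite ltnS direct_levels_le.
    rewrite mulrDr -[leLHS]add0r lerD//.
      by rewrite mulr_ge0 ?(ltW E0)// sumr_ge0// => k _; exact: level_cost_ge0.
    rewrite mulr_sumr; apply: ler_sum_nat => k kx.
    by have := levelP (t, k) kx => /=; rewrite (ger0_norm (level_cost_ge0 _ _ _)).
  by rewrite ler_wpM2l ?(ltW E0)// sum_level_cost lerD// ler_wpM2l.
have := directP t I; rewrite -/x (ger0_norm M0) => direct.
have cost0 : 0 <= total_cost x.
  by rewrite /total_cost -/a -/b; apply: addr_ge0 => //; apply: addr_ge0; apply: mulr_ge0.
rewrite (ger0_norm cost0) total_workE (le_trans (ler_normD _ _))//.
apply: le_trans (lerD direct corrected) _.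
rewrite /total_cost -/a -/b.
have aN : 0 <= a * (fine_dof x)%:R by rewrite mulr_ge0.
have bl : 0 <= b * ln (fine_dof x)%:R by rewrite mulr_ge0.
(* [u] and [v] are the first two terms of [total_cost]. What remains is a linear inequality in [u],
   [v] and [direct_cost x]. *)
rewrite mulrCA (mulrCA b); set u := a * _ in aN *; set v := b * _ in bl *.
have Du : 0 <= D * (u + v) by rewrite mulr_ge0 ?addr_ge0// ltW.
have EM : 0 <= E * ((G + K) * direct_cost x).
  by rewrite mulr_ge0 ?(ltW E0)// mulr_ge0// addr_ge0// ltW.
have EKu : 0 <= E * (K * u + G * v).
  by rewrite mulr_ge0 ?(ltW E0)// addr_ge0// mulr_ge0// ltW.
(* The difference of the two sides consists of the cross terms of the product of the constant with
   the cost, all nonnegative. *)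
rewrite -subr_ge0 [leRHS](_ : _ = D * (u + v) + E * ((G + K) * direct_cost x)
  + E * (K * u + G * v)); last by ring.
by rewrite !addr_ge0.
Qed.
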